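(* Let $x:S\to\mathbb{R}^3_1$ be a space-like constant slope surface immersed in $\mathbb{R}^3_1$ which lies in the space-like cone, parametrized by $$x(u,v)=u\cosh\theta\,\big(\cosh\xi_1(u)\,f(v)+\sinh\xi_1(u)\,f(v)\times f'(v)\big),$$ where $\theta$ is a constant different from $0$, $\xi_1(u)=\tanh\theta\,\ln u$ and $f$ is a unit speed space-like curve on $\mathbb{S}^2_1$. If $x(v)$ is a $v$-parameter curve of the surface $x(u,v)$ (that is, $x(v)=x(u,v)$ with $u$ constant), then $\int_0^v x(v)\,dv$ is a space-like Bertrand curve.
   Context: Minkowski 3-space $\mathbb{R}^3_1$ is $\mathbb{R}^3$ with $\langle x,y\rangle=x_1y_1+x_2y_2-x_3y_3$ and $\|x\|=\sqrt{|\langle x,x\rangle|}$. A vector $x$ is space-like if $\langle x,x\rangle>0$ or $x=0$, time-like if $\langle x,x\rangle<0$, light-like if $\langle x,x\rangle=0$ and $x\neq0$. A regular curve is space-like (time-like) if all its velocity vectors are; it is unit speed if its velocity has pseudo-norm $1$. The Lorentzian cross product is $x\times y=(x_2y_3-x_3y_2,\;x_3y_1-x_1y_3,\;x_2y_1-x_1y_2)$, so that $\langle x\times y,z\rangle=\det(x,y,z)$. De Sitter 2-space is $\mathbb{S}^2_1=\{x\in\mathbb{R}^3_1:\langle x,x\rangle=1\}$. A space-like constant slope surface is a space-like surface whose position vector makes a constant angle with the normal at each point. By a known classification (Fu and Yang), the space-like constant slope surfaces lying in the space-like cone (the region where position vectors are space-like) are exactly those that can be parametrized in the form given in the claim. For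 a space-like curve $\alpha$ with arc-length parameter $s$, it is assumed that $T'(s)$ is space-like, where $T=\alpha'$. The Frenet frame is $T=\alpha'$, $N=\alpha''/\|\alpha''\|$, $B=N\times T$; the curvature is $\kappa=\|T'\|$ and the torsion is $\tau=-\langle N',B\rangle$. A space-like curve is a (space-like) Bertrand curve if and only if there are non-zero real constants $A,B$ such that $A\kappa(s)+B\tau(s)=1$ for all $s$.
   Formalization: The parameter curve u = 1 is excluded: there ξ_1 = 0, so the integral curve has constant curvature, and if the geodesic curvature of f is not constant, Aκ+Bτ=1 forces B = 0, so the criterion with non-zero A, B fails. *)

(* Defs.v *)
(* Stdlib real numbers with Coquelicot.  Minkowski 3-space is R * R * R with
   Coquelicot's product vector-space operations [plus] and [scal]. *)
From Stdlib Require Import Reals.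
From Coquelicot Require Import Coquelicot.
Open Scope R_scope.

Definition vec : Type := (R * R * R)%type.

Definition c1 (x : vec) : R := fst (fst x).
Definition c2 (x : vec) : R := snd (fst x).
Definition c3 (x : vec) : R := snd x.

Definition vzero : vec := (0, 0, 0).
Definition vadd (x y : vec) : vec := plus x y.
Definition vscal (a : R) (x : vec) : vec := scal a x.

Definition lip (x y : vec) : R := c1 x * c1 y + c2 x * c2 y - c3 x * c3 y.
Definition pnorm (x : vec) : R := sqrt (Rabs (lip x x)).

Definition lcross (x y : vec) : vec :=
  (c2 x * c3 y - c3 x * c2 y,
   c3 x * c1 y - c1 x * c3 y,
   c2 x * c1 y - c1 x * c2 y).

Definition spacelike (x : vec) : Prop := lip x x > 0 \/ x = vzero.

Definition de_sitter (x : vec) : Prop := lip x x = 1.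

(* [Derive] and [RInt] are total, so these carry meaning only together with the
   smoothness assumptions below. *)
Definition vderive (f : R -> vec) (t : R) : vec :=
  (Derive (fun r => c1 (f r)) t,
   Derive (fun r => c2 (f r)) t,
   Derive (fun r => c3 (f r)) t).

Definition vint (f : R -> vec) (a b : R) : vec :=
  (RInt (fun r => c1 (f r)) a b,
   RInt (fun r => c2 (f r)) a b,
   RInt (fun r => c3 (f r)) a b).

(* The open interval ]a, b[, possibly unbounded. *)
Definition in_itv (a b : Rbar) (t : R) : Prop := Rbar_lt a t /\ Rbar_lt t b.

Definition smooth_on (a b : Rbar) (f : R -> R) : Prop :=
  forall (n : nat) (t : R), in_itv a b t -> ex_derive_n f n t.

Definition vsmooth_on (a b : Rbar) (f : R -> vec) : Prop :=
  smooth_on a b (fun t => c1 (f t)) /\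
  smooth_on a b (fun t => c2 (f t)) /\
  smooth_on a b (fun t => c3 (f t)).

Definition regular_curve (a b : Rbar) (f : R -> vec) : Prop :=
  vsmooth_on a b f /\ forall t, in_itv a b t -> vderive f t <> vzero.

Definition spacelike_curve (a b : Rbar) (f : R -> vec) : Prop :=
  regular_curve a b f /\ forall t, in_itv a b t -> spacelike (vderive f t).

Definition unit_speed (a b : Rbar) (f : R -> vec) : Prop :=
  forall t, in_itv a b t -> pnorm (vderive f t) = 1.

(* Frenet apparatus of a curve [al] parametrized by arc length. *)

Definition frT (al : R -> vec) : R -> vec := vderive al.

Definition frN (al : R -> vec) (s : R) : vec :=
  vscal (/ pnorm (vderive (frT al) s)) (vderive (frT al) s).

Definition frB (al : R -> vec) (s : R) : vec := lcross (frN al s) (frT al s).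

Definition curvature (al : R -> vec) (s : R) : R := pnorm (vderive (frT al) s).

Definition torsion (al : R -> vec) (s : R) : R :=
  - lip (vderive (frN al) s) (frB al s).

(* Space-like unit speed curves with T' space-like; T' must also be non-zero
   for N to be defined. *)
Definition spacelike_frenet_curve (a b : Rbar) (al : R -> vec) : Prop :=
  spacelike_curve a b al /\ unit_speed a b al /\
  forall s, in_itv a b s ->
    spacelike (vderive (frT al) s) /\ vderive (frT al) s <> vzero.

(* [al] on ]c, d[ is [ga] on ]a, b[ precomposed with an orientation-preserving
   diffeomorphism ]c, d[ -> ]a, b[. *)
Definition reparametrization (a b : Rbar) (ga : R -> vec)
    (c d : Rbar) (al : R -> vec) : Prop :=
  exists phi : R -> R,
    smooth_on c d phi /\
    (forall s, in_itv c d s ->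
       in_itv a b (phi s) /\ 0 < Derive phi s /\ al s = ga (phi s)) /\
    (forall t, in_itv a b t -> exists s, in_itv c d s /\ phi s = t).

(* The Bertrand condition refers to arc length, so for a curve with an arbitrary
   parameter it is imposed on an arc-length reparametrization (unique up to a
   translation of the parameter). *)
Definition spacelike_Bertrand_curve (a b : Rbar) (ga : R -> vec) : Prop :=
  spacelike_curve a b ga /\
  exists (c d : Rbar) (al : R -> vec),
    reparametrization a b ga c d al /\
    spacelike_frenet_curve c d al /\
    exists A B : R, A <> 0 /\ B <> 0 /\
      forall s, in_itv c d s -> A * curvature al s + B * torsion al s = 1.

(* Surfaces parametrized over the open rectangle ]u1, u2[ x ]a, b[. *)

Definition pder_u (x : R -> R -> vec) (u v : R) : vec := vderive (fun r => x r v) u.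
Definition pder_v (x : R -> R -> vec) (u v : R) : vec := vderive (fun r => x u r) v.

Definition vsmooth2_on (u1 u2 a b : Rbar) (x : R -> R -> vec) : Prop :=
  forall (n : nat) (u v : R), in_itv u1 u2 u -> in_itv a b v ->
    ex_diff_n (fun p q => c1 (x p q)) n u v /\
    ex_diff_n (fun p q => c2 (x p q)) n u v /\
    ex_diff_n (fun p q => c3 (x p q)) n u v.

Definition tangent (x : R -> R -> vec) (u v : R) (p q : R) : vec :=
  vadd (vscal p (pder_u x u v)) (vscal q (pder_v x u v)).

Definition immersed_surface (u1 u2 a b : Rbar) (x : R -> R -> vec) : Prop :=
  vsmooth2_on u1 u2 a b x /\
  forall u v, in_itv u1 u2 u -> in_itv a b v ->
    forall p q, tangent x u v p q = vzero -> p = 0 /\ q = 0.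

Definition spacelike_surface (u1 u2 a b : Rbar) (x : R -> R -> vec) : Prop :=
  immersed_surface u1 u2 a b x /\
  forall u v, in_itv u1 u2 u -> in_itv a b v ->
    forall p q, spacelike (tangent x u v p q).

Definition in_spacelike_cone (u1 u2 a b : Rbar) (x : R -> R -> vec) : Prop :=
  forall u v, in_itv u1 u2 u -> in_itv a b v -> spacelike (x u v).

Definition normal_vector (x : R -> R -> vec) (u v : R) (n : vec) : Prop :=
  n <> vzero /\ forall p q, lip n (tangent x u v p q) = 0.

(* The angle phi >= 0 between a space-like vector y and a time-like vector n is
   given by |<y, n>| = ||y|| ||n|| sinh phi.  In the space-like cone the position
   vector is space-like, while normals of a space-like surface are time-like. *)
Definition constant_angle_with_normal
    (u1 u2 a b : Rbar) (x : R -> R -> vec) : Prop :=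
  exists phi : R, 0 <= phi /\
  forall u v, in_itv u1 u2 u -> in_itv a b v ->
    forall n, normal_vector x u v n ->
      Rabs (lip (x u v) n) = pnorm (x u v) * pnorm n * sinh phi.

(* A space-like constant slope surface lying in the space-like cone. *)
Definition spacelike_constant_slope_surface
    (u1 u2 a b : Rbar) (x : R -> R -> vec) : Prop :=
  spacelike_surface u1 u2 a b x /\
  in_spacelike_cone u1 u2 a b x /\
  constant_angle_with_normal u1 u2 a b x.

Definition xi1 (theta u : R) : R := tanh theta * ln u.

Definition slope_param (theta : R) (f : R -> vec) (u v : R) : vec :=
  vscal (u * cosh theta)
    (vadd (vscal (cosh (xi1 theta u)) (f v))
          (vscal (sinh (xi1 theta u)) (lcross (f v) (vderive f v)))).

(* Main.v *)
From Stdlib Require Import Reals Ranalysis5 Lra Lia.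
From Coquelicot Require Import Coquelicot.
(* This import is last so that [c1], [c2], [c3] are the coordinates of a vector
   and [c1] is not the projection of [C1_fun]. *)
Require Import Defs.
Open Scope R_scope.

(** The curve [ga] obtained by integrating [x u0] has velocity
    [lam T], where [lam = u0 cosh theta] is constant, [h = f x f'] and
    [T = cosh xi f + sinh xi h] with [xi = xi1 theta u0] constant too.  Since
    [f], [f'], [h] are orthonormal ([h] being time-like), [T] is a unit
    space-like vector: [lam v] is an arc length of [ga], and [T] is its tangent.

    Put [k = <h, f''>].  Both [f] and [f''] are orthogonal to the unit vector
    [f'], so [f x f''] is a multiple of [f'] ([lcross_of_orthogonal]); thus
    [h' = - k f'] and [T' = (cosh xi - k sinh xi) f'] with respect to [v].  The
    surface being immersed, [T'] is nowhere zero, so [w = cosh xi - k sinh xi]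
    has a constant sign [sg] and the principal normal is [sg f'].  Hence
      [curvature = sg (cosh xi - k sinh xi) / lam] and
      [torsion = - (sinh xi - k cosh xi) / lam]
    ([curvature_of_tilt_integral], [torsion_of_tilt_integral]), and
    [cosh^2 - sinh^2 = 1] eliminates [k]:
      [(sg lam cosh xi) curvature + (lam sinh xi) torsion = 1].
    The coefficient of the torsion is non-zero because [theta <> 0] and
    [u0 <> 1] give [xi <> 0]. *)

(** * Open intervals *)

Lemma in_itv_locally (a b : Rbar) (t : R) (P : R -> Prop) :
  in_itv a b t -> (forall y, in_itv a b y -> P y) -> locally t P.
Proof.
  intros Ht HP.
  apply locally_open with (D := in_itv a b); auto.
  apply open_and; [apply open_Rbar_gt | apply open_Rbar_lt].
Qed.

Lemma in_itv_convex (a b : Rbar) (s t z : R) :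
  in_itv a b s -> in_itv a b t -> s <= z <= t -> in_itv a b z.
Proof.
  intros [Hs _] [_ Ht] Hz; split.
  - apply Rbar_lt_le_trans with s; auto; apply Hz.
  - apply Rbar_le_lt_trans with t; auto; apply Hz.
Qed.

Lemma in_itv_between (a b : Rbar) (s t z : R) :
  in_itv a b s -> in_itv a b t -> Rmin s t <= z <= Rmax s t -> in_itv a b z.
Proof.
  unfold Rmin, Rmax; destruct (Rle_dec s t); intros Hs Ht Hz.
  - now apply in_itv_convex with s t.
  - now apply in_itv_convex with t s.
Qed.

Lemma in_itv_mult_pos (a b : Rbar) (m : posreal) (t : R) :
  in_itv (Rbar_mult_pos a m) (Rbar_mult_pos b m) (t * m) <-> in_itv a b t.
Proof.
  unfold in_itv.
  change (Finite (t * m)) with (Rbar_mult_pos t m).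
  now rewrite <- !Rbar_mult_pos_lt.
Qed.

(** * Smooth functions on an open interval *)

Lemma smooth_on_ex_derive (a b : Rbar) (f : R -> R) (t : R) :
  smooth_on a b f -> in_itv a b t -> ex_derive f t.
Proof. intros Hf; exact (Hf 1%nat t). Qed.

Lemma smooth_on_continuous (a b : Rbar) (f : R -> R) (t : R) :
  smooth_on a b f -> in_itv a b t -> continuous f t.
Proof.
  intros Hf Ht; apply (@ex_derive_continuous R_AbsRing R_NormedModule).
  now apply smooth_on_ex_derive with a b.
Qed.

Lemma smooth_on_ext (a b : Rbar) (f g : R -> R) :
  (forall t, in_itv a b t -> f t = g t) -> smooth_on a b f -> smooth_on a b g.
Proof.
  intros E Hf n t Ht; apply ex_derive_n_ext_loc with f; auto.
  now apply (in_itv_locally a b).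
Qed.

Lemma ex_derive_n_Derive (f : R -> R) (n : nat) (t : R) :
  ex_derive_n f (S (S n)) t <-> ex_derive_n (Derive f) (S n) t.
Proof.
  assert (E : forall y, Derive_n (Derive f) n y = Derive_n f (S n) y).
  { intros y; rewrite <- (Nat.add_1_r n); exact (Derive_n_comp f n 1 y). }
  simpl; split; apply ex_derive_ext; intros y; now rewrite E.
Qed.

Lemma smooth_on_Derive (a b : Rbar) (f : R -> R) :
  smooth_on a b f -> smooth_on a b (Derive f).
Proof.
  intros Hf [|n] t Ht; [exact I|].
  apply (proj1 (ex_derive_n_Derive f n t)), Hf, Ht.
Qed.

Lemma smooth_on_primitive (a b : Rbar) (F f : R -> R) :
  (forall t, in_itv a b t -> is_derive F t (f t)) ->
  smooth_on a b f -> smooth_on a b F.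
Proof.
  intros HF Hf [|[|n]] t Ht.
  - exact I.
  - exists (f t); now apply HF.
  - apply (proj2 (ex_derive_n_Derive F n t)), ex_derive_n_ext_loc with f;
      [|now apply Hf].
    apply (in_itv_locally a b); auto.
    intros y Hy; symmetry; now apply is_derive_unique, HF.
Qed.

Lemma smooth_on_plus (a b : Rbar) (f g : R -> R) :
  smooth_on a b f -> smooth_on a b g -> smooth_on a b (fun t => f t + g t).
Proof.
  intros Hf Hg n t Ht; apply ex_derive_n_plus;
    apply (in_itv_locally a b); auto.
Qed.

Lemma smooth_on_minus (a b : Rbar) (f g : R -> R) :
  smooth_on a b f -> smooth_on a b g -> smooth_on a b (fun t => f t - g t).
Proof.
  intros Hf Hg n t Ht; apply ex_derive_n_minus;
    apply (in_itv_locally a b); auto.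
Qed.

Lemma smooth_on_scal (a b : Rbar) (c : R) (f : R -> R) :
  smooth_on a b f -> smooth_on a b (fun t => c * f t).
Proof. intros Hf n t Ht; apply ex_derive_n_scal_l; now apply Hf. Qed.

(** Leibniz: the derivative [f' g + f g'] is again a sum of products of smooth
    functions, so the order of differentiability goes up by induction over all
    pairs of smooth functions at once. *)
Lemma smooth_on_mult (a b : Rbar) (f g : R -> R) :
  smooth_on a b f -> smooth_on a b g -> smooth_on a b (fun t => f t * g t).
Proof.
  intros Hf Hg n; revert f g Hf Hg.
  induction n as [n IH] using (well_founded_induction Nat.lt_wf_0).
  intros f g Hf Hg t Ht.
  destruct n as [|[|n]]; [exact I | |].
  { apply (ex_derive_mult f g); now apply smooth_on_ex_derive with a b. }
  apply (proj2 (ex_derive_n_Derive (fun y => f y * g y) n t)).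
  apply ex_derive_n_ext_loc with (fun y => Derive f y * g y + f y * Derive g y).
  - apply (in_itv_locally a b); auto; intros y Hy.
    symmetry; apply Derive_mult; now apply smooth_on_ex_derive with a b.
  - apply ex_derive_n_plus; apply (in_itv_locally a b); auto;
      intros y Hy k Hk; apply IH; auto using smooth_on_Derive; lia.
Qed.

(** If two values had opposite signs, the function would vanish somewhere
    between, by the intermediate value theorem. *)
Lemma nonvanishing_constant_sign (a b : Rbar) (f : R -> R) :
  (forall t, in_itv a b t -> continuous f t) ->
  (forall t, in_itv a b t -> f t <> 0) ->
  forall s t, in_itv a b s -> in_itv a b t -> 0 < f s * f t.
Proof.
  intros Hc Hn.
  (* it is enough to compare values at ordered points *)
  assert (H : forall s t, in_itv a b s -> in_itv a b t -> s < t ->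
    0 < f s * f t).
  { intros s t Hs Ht Hst.
    assert (Ns := Hn s Hs); assert (Nt := Hn t Ht).
    assert (C : forall z, s <= z <= t -> continuity_pt f z).
    { intros z Hz; apply continuity_pt_filterlim, Hc.
      now apply in_itv_convex with s t. }
    destruct (Rlt_or_le 0 (f s * f t)) as [|Hle]; auto; exfalso.
    destruct (Rlt_or_le (f s) 0) as [Hneg|Hpos].
    - destruct (IVT_interv f s t) as [z [Hz Ez]]; auto; [nra|].
      apply (Hn z); auto; now apply in_itv_convex with s t.
    - destruct (IVT_interv (fun y => - f y) s t) as [z [Hz Ez]]; auto.
      + intros z Hz; apply continuity_pt_opp; auto.
      + lra.
      + nra.
      + apply (Hn z); [now apply in_itv_convex with s t | lra]. }
  intros s t Hs Ht.
  destruct (Rtotal_order s t) as [Hst|[->|Hst]]; auto.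
  - assert (Nt := Hn t Ht); nra.
  - rewrite Rmult_comm; auto.
Qed.

Lemma is_derive_RInt_on (a b : Rbar) (f : R -> R) (t0 t : R) :
  (forall y, in_itv a b y -> continuous f y) ->
  in_itv a b t0 -> in_itv a b t -> is_derive (RInt f t0) t (f t).
Proof.
  intros Hc H0 Ht; apply is_derive_RInt with t0; auto.
  apply (in_itv_locally a b); auto; intros y Hy.
  apply (RInt_correct (V := R_CompleteNormedModule)), ex_RInt_continuous.
  intros z Hz; apply Hc; now apply in_itv_between with t0 y.
Qed.


Lemma smooth_on_rescale (a b : Rbar) (m : posreal) (f : R -> R) :
  smooth_on a b f ->
  smooth_on (Rbar_mult_pos a m) (Rbar_mult_pos b m) (fun s => f (/ m * s)).
Proof.
  intros Hf n s Hs; apply ex_derive_n_comp_scal.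
  apply (in_itv_locally a b); [|intros; now apply Hf].
  apply in_itv_mult_pos with m.
  replace (/ m * s * m) with s; auto.
  field; apply Rgt_not_eq, cond_pos.
Qed.

(** * Lorentzian algebra *)

Lemma vec_ext (x y : vec) : c1 x = c1 y -> c2 x = c2 y -> c3 x = c3 y -> x = y.
Proof.
  destruct x as [[x1 x2] x3], y as [[y1 y2] y3]; unfold c1, c2, c3; simpl.
  now intros -> -> ->.
Qed.

(** These are definitional equalities; rewriting with them keeps the operations
    in the real field, where [ring] applies, instead of in the abstract product
    module. *)
Lemma coords_vadd (x y : vec) :
  c1 (vadd x y) = c1 x + c1 y /\ c2 (vadd x y) = c2 x + c2 y /\
  c3 (vadd x y) = c3 x + c3 y.
Proof. now repeat split. Qed.

Lemma coords_vscal (p : R) (x : vec) :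
  c1 (vscal p x) = p * c1 x /\ c2 (vscal p x) = p * c2 x /\
  c3 (vscal p x) = p * c3 x.
Proof. now repeat split. Qed.

Ltac coords :=
  repeat first
    [ rewrite (proj1 (coords_vadd _ _))
    | rewrite (proj1 (proj2 (coords_vadd _ _)))
    | rewrite (proj2 (proj2 (coords_vadd _ _)))
    | rewrite (proj1 (coords_vscal _ _))
    | rewrite (proj1 (proj2 (coords_vscal _ _)))
    | rewrite (proj2 (proj2 (coords_vscal _ _)))
    | progress unfold lip, lcross, vzero
    | progress cbn [c1 c2 c3 fst snd] ].

Lemma vscal_1 (x : vec) : vscal 1 x = x.
Proof. apply vec_ext; coords; ring. Qed.

Lemma vscal_0 (x : vec) : vscal 0 x = vzero.
Proof. apply vec_ext; coords; ring. Qed.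

Lemma vscal_vscal (p q : R) (x : vec) : vscal p (vscal q x) = vscal (p * q) x.
Proof. apply vec_ext; coords; ring. Qed.

Lemma lip_sym (x y : vec) : lip x y = lip y x.
Proof. coords; ring. Qed.

Lemma lip_vscal (p q : R) (x y : vec) :
  lip (vscal p x) (vscal q y) = p * q * lip x y.
Proof. coords; ring. Qed.

Lemma lip_vzero : lip vzero vzero = 0.
Proof. coords; ring. Qed.

Lemma nonnull_nonzero (x : vec) : lip x x <> 0 -> x <> vzero.
Proof. intros H ->; apply H, lip_vzero. Qed.

Lemma lcross_self (x : vec) : lcross x x = vzero.
Proof. apply vec_ext; coords; ring. Qed.

Lemma pnorm_vscal_unit (p : R) (x : vec) :
  lip x x = 1 -> pnorm (vscal p x) = Rabs p.
Proof.
  intros H; unfold pnorm; rewrite lip_vscal, H, Rmult_1_r.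
  rewrite Rabs_pos_eq by nra; exact (sqrt_Rsqr_abs p).
Qed.

Lemma spacelike_pnorm_unit (x : vec) :
  spacelike x -> pnorm x = 1 -> lip x x = 1.
Proof.
  unfold pnorm; intros [Hx | ->] Hn.
  - rewrite Rabs_pos_eq in Hn by lra.
    rewrite <- (sqrt_sqrt (lip x x)) by lra; rewrite Hn; ring.
  - rewrite lip_vzero, Rabs_R0, sqrt_0 in Hn; lra.
Qed.

(** The Lorentzian triple product, with signs opposite to the Euclidean ones. *)
Lemma lcross_lcross (x y z : vec) :
  lcross x (lcross y z)
  = vadd (vscal (lip x y) z) (vscal (- lip x z) y).
Proof. apply vec_ext; coords; ring. Qed.

(** The triple product shows that [lcross t (lcross x y)] vanishes; taking its
    cross product with [t] once more expresses [lcross x y] through [t]. *)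
Lemma lcross_of_orthogonal (t x y : vec) :
  lip t t = 1 -> lip t x = 0 -> lip t y = 0 ->
  lcross x y = vscal (lip t (lcross x y)) t.
Proof.
  intros Ht Hx Hy.
  assert (E : lcross t (lcross x y) = vzero).
  { rewrite lcross_lcross, Hx, Hy; apply vec_ext; coords; ring. }
  assert (E2 := lcross_lcross t t (lcross x y)).
  rewrite E, Ht in E2.
  revert E2; generalize (lip t (lcross x y)), (lcross x y); intros p z E2.
  assert (E3 := f_equal c1 E2); assert (E4 := f_equal c2 E2);
    assert (E5 := f_equal c3 E2).
  revert E3 E4 E5; coords; intros E3 E4 E5.
  apply vec_ext; coords; lra.
Qed.

Lemma lip_lcross_self (x y : vec) : lip (lcross x y) (lcross x y)
  = lip x y * lip x y - lip x x * lip y y.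
Proof. coords; ring. Qed.

(** * Derivatives of vector-valued functions *)

Definition is_vderive (f : R -> vec) (t : R) (l : vec) : Prop :=
  is_derive (fun r => c1 (f r)) t (c1 l) /\
  is_derive (fun r => c2 (f r)) t (c2 l) /\
  is_derive (fun r => c3 (f r)) t (c3 l).

Lemma is_vderive_unique (f : R -> vec) (t : R) (l : vec) :
  is_vderive f t l -> vderive f t = l.
Proof.
  intros (H1 & H2 & H3); apply vec_ext; now apply is_derive_unique.
Qed.

Lemma is_vderive_ext_loc (f g : R -> vec) (t : R) (l : vec) :
  locally t (fun y => f y = g y) -> is_vderive f t l -> is_vderive g t l.
Proof.
  intros E (H1 & H2 & H3).
  split; [|split].
  - apply is_derive_ext_loc with (2 := H1); revert E; apply filter_imp.
    now intros y ->.
  - apply is_derive_ext_loc with (2 := H2); revert E; apply filter_imp.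
    now intros y ->.
  - apply is_derive_ext_loc with (2 := H3); revert E; apply filter_imp.
    now intros y ->.
Qed.

Lemma is_derive_Rmult (f g : R -> R) (t p q : R) :
  is_derive f t p -> is_derive g t q ->
  is_derive (fun r => f r * g r) t (p * g t + f t * q).
Proof.
  intros Hf Hg; apply (is_derive_mult f g t p q Hf Hg); exact Rmult_comm.
Qed.

Lemma is_vderive_vadd (f g : R -> vec) (t : R) (p q : vec) :
  is_vderive f t p -> is_vderive g t q ->
  is_vderive (fun r => vadd (f r) (g r)) t (vadd p q).
Proof.
  intros (H1 & H2 & H3) (K1 & K2 & K3).
  split; [|split].
  - exact (is_derive_plus _ _ _ _ _ H1 K1).
  - exact (is_derive_plus _ _ _ _ _ H2 K2).
  - exact (is_derive_plus _ _ _ _ _ H3 K3).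
Qed.

Lemma is_vderive_vscal (c : R) (f : R -> vec) (t : R) (p : vec) :
  is_vderive f t p -> is_vderive (fun r => vscal c (f r)) t (vscal c p).
Proof.
  intros (H1 & H2 & H3).
  split; [|split].
  - exact (is_derive_scal _ _ c _ H1).
  - exact (is_derive_scal _ _ c _ H2).
  - exact (is_derive_scal _ _ c _ H3).
Qed.

Lemma is_derive_cross_term (f g h k : R -> R) (t df dg dh dk : R) :
  is_derive f t df -> is_derive g t dg -> is_derive h t dh -> is_derive k t dk ->
  is_derive (fun r => f r * g r - h r * k r) t
    ((df * g t - dh * k t) + (f t * dg - h t * dk)).
Proof.
  intros Hf Hg Hh Hk.
  replace ((df * g t - dh * k t) + (f t * dg - h t * dk))
    with ((df * g t + f t * dg) - (dh * k t + h t * dk)) by ring.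
  exact (is_derive_minus _ _ _ _ _ (is_derive_Rmult f g t df dg Hf Hg)
    (is_derive_Rmult h k t dh dk Hh Hk)).
Qed.

Lemma is_vderive_lcross (f g : R -> vec) (t : R) (p q : vec) :
  is_vderive f t p -> is_vderive g t q ->
  is_vderive (fun r => lcross (f r) (g r)) t
    (vadd (lcross p (g t)) (lcross (f t) q)).
Proof.
  intros (H1 & H2 & H3) (K1 & K2 & K3).
  split; [|split].
  - exact (is_derive_cross_term _ _ _ _ _ _ _ _ _ H2 K3 H3 K2).
  - exact (is_derive_cross_term _ _ _ _ _ _ _ _ _ H3 K1 H1 K3).
  - exact (is_derive_cross_term _ _ _ _ _ _ _ _ _ H2 K1 H1 K2).
Qed.

Lemma is_derive_lip (f g : R -> vec) (t : R) (p q : vec) :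
  is_vderive f t p -> is_vderive g t q ->
  is_derive (fun r => lip (f r) (g r)) t (lip p (g t) + lip (f t) q).
Proof.
  intros (H1 & H2 & H3) (K1 & K2 & K3).
  assert (D1 := is_derive_Rmult _ _ _ _ _ H1 K1).
  assert (D2 := is_derive_Rmult _ _ _ _ _ H2 K2).
  assert (D3 := is_derive_Rmult _ _ _ _ _ H3 K3).
  assert (D := is_derive_minus _ _ _ _ _ (is_derive_plus _ _ _ _ _ D1 D2) D3).
  evar_last; [exact D|].
  unfold lip, minus, plus, opp; simpl; ring.
Qed.

Lemma is_derive_rescale (f : R -> R) (k s l : R) :
  is_derive f (k * s) l -> is_derive (fun r => f (k * r)) s (k * l).
Proof.
  intros H.
  apply (is_derive_comp f (fun r => k * r) s l k H).
  auto_derive; auto; ring.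
Qed.

Lemma is_vderive_rescale (f : R -> vec) (k s : R) (l : vec) :
  is_vderive f (k * s) l ->
  is_vderive (fun r => f (k * r)) s (vscal k l).
Proof.
  intros (H1 & H2 & H3).
  split; [|split].
  - exact (is_derive_rescale _ _ _ _ H1).
  - exact (is_derive_rescale _ _ _ _ H2).
  - exact (is_derive_rescale _ _ _ _ H3).
Qed.

Lemma vsmooth_on_is_vderive (a b : Rbar) (f : R -> vec) (t : R) :
  vsmooth_on a b f -> in_itv a b t -> is_vderive f t (vderive f t).
Proof.
  intros (H1 & H2 & H3) Ht.
  split; [|split]; apply Derive_correct; now apply smooth_on_ex_derive with a b.
Qed.

Lemma vsmooth_on_vderive (a b : Rbar) (f : R -> vec) :
  vsmooth_on a b f -> vsmooth_on a b (vderive f).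
Proof.
  intros (H1 & H2 & H3).
  split; [|split]; now apply smooth_on_Derive.
Qed.

Lemma vsmooth_on_ext (a b : Rbar) (f g : R -> vec) :
  (forall t, in_itv a b t -> f t = g t) -> vsmooth_on a b f -> vsmooth_on a b g.
Proof.
  intros E (H1 & H2 & H3).
  split; [|split];
    [apply smooth_on_ext with (2 := H1) | apply smooth_on_ext with (2 := H2)
    | apply smooth_on_ext with (2 := H3)]; intros t Ht; now rewrite E.
Qed.

Lemma vsmooth_on_vadd (a b : Rbar) (f g : R -> vec) :
  vsmooth_on a b f -> vsmooth_on a b g ->
  vsmooth_on a b (fun t => vadd (f t) (g t)).
Proof.
  intros (H1 & H2 & H3) (K1 & K2 & K3).
  split; [|split].
  - exact (smooth_on_plus _ _ _ _ H1 K1).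
  - exact (smooth_on_plus _ _ _ _ H2 K2).
  - exact (smooth_on_plus _ _ _ _ H3 K3).
Qed.

Lemma vsmooth_on_vscal (a b : Rbar) (c : R) (f : R -> vec) :
  vsmooth_on a b f -> vsmooth_on a b (fun t => vscal c (f t)).
Proof.
  intros (H1 & H2 & H3).
  split; [|split].
  - exact (smooth_on_scal _ _ c _ H1).
  - exact (smooth_on_scal _ _ c _ H2).
  - exact (smooth_on_scal _ _ c _ H3).
Qed.

Lemma vsmooth_on_lcross (a b : Rbar) (f g : R -> vec) :
  vsmooth_on a b f -> vsmooth_on a b g ->
  vsmooth_on a b (fun t => lcross (f t) (g t)).
Proof.
  intros (H1 & H2 & H3) (K1 & K2 & K3).
  split; [|split]; apply smooth_on_minus; now apply smooth_on_mult.
Qed.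

Lemma smooth_on_lip (a b : Rbar) (f g : R -> vec) :
  vsmooth_on a b f -> vsmooth_on a b g ->
  smooth_on a b (fun t => lip (f t) (g t)).
Proof.
  intros (H1 & H2 & H3) (K1 & K2 & K3).
  apply smooth_on_minus; [apply smooth_on_plus|]; now apply smooth_on_mult.
Qed.

Lemma is_vderive_vint (a b : Rbar) (f : R -> vec) (t0 t : R) :
  vsmooth_on a b f -> in_itv a b t0 -> in_itv a b t ->
  is_vderive (fun v => vint f t0 v) t (f t).
Proof.
  intros (H1 & H2 & H3) H0 Ht.
  split; [|split]; simpl.
  - apply (is_derive_RInt_on a b (fun r => c1 (f r))); auto.
    intros; now apply smooth_on_continuous with a b.
  - apply (is_derive_RInt_on a b (fun r => c2 (f r))); auto.
    intros; now apply smooth_on_continuous with a b.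
  - apply (is_derive_RInt_on a b (fun r => c3 (f r))); auto.
    intros; now apply smooth_on_continuous with a b.
Qed.

Lemma vsmooth_on_primitive (a b : Rbar) (F f : R -> vec) :
  (forall t, in_itv a b t -> is_vderive F t (f t)) ->
  vsmooth_on a b f -> vsmooth_on a b F.
Proof.
  intros HF (H1 & H2 & H3).
  split; [|split];
    [apply smooth_on_primitive with (2 := H1)
    | apply smooth_on_primitive with (2 := H2)
    | apply smooth_on_primitive with (2 := H3)]; intros t Ht; now apply HF.
Qed.

Lemma vsmooth_on_rescale (a b : Rbar) (m : posreal) (f : R -> vec) :
  vsmooth_on a b f ->
  vsmooth_on (Rbar_mult_pos a m) (Rbar_mult_pos b m) (fun s => f (/ m * s)).
Proof.
  intros (H1 & H2 & H3).
  split; [|split].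
  - exact (smooth_on_rescale _ _ m _ H1).
  - exact (smooth_on_rescale _ _ m _ H2).
  - exact (smooth_on_rescale _ _ m _ H3).
Qed.

Lemma is_derive_constant_on (a b : Rbar) (f : R -> R) (c t l : R) :
  (forall y, in_itv a b y -> f y = c) -> in_itv a b t ->
  is_derive f t l -> l = 0.
Proof.
  intros E Ht H.
  apply is_derive_unique in H; rewrite <- H.
  rewrite (Derive_ext_loc f (fun _ => c)); [apply Derive_const|].
  now apply (in_itv_locally a b).
Qed.

(** * Hyperbolic functions *)

Lemma cosh_sqr_sinh_sqr (x : R) : cosh x * cosh x - sinh x * sinh x = 1.
Proof.
  unfold cosh, sinh.
  assert (E : exp x * exp (- x) = 1) by (rewrite <- exp_plus, Rplus_opp_r; apply exp_0).
  lra.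
Qed.

Lemma cosh_pos (x : R) : 0 < cosh x.
Proof.
  unfold cosh; assert (H := exp_pos x); assert (H' := exp_pos (- x)); lra.
Qed.

Lemma sinh_neq_0 (x : R) : x <> 0 -> sinh x <> 0.
Proof.
  unfold sinh; intros Hx H.
  assert (E : x = - x) by (apply exp_inv; lra).
  lra.
Qed.

Lemma xi1_neq_0 (theta u : R) :
  theta <> 0 -> 0 < u -> u <> 1 -> xi1 theta u <> 0.
Proof.
  intros Ht Hu Hu1; unfold xi1, tanh.
  assert (Hs := sinh_neq_0 theta Ht); assert (Hc := cosh_pos theta).
  apply Rmult_integral_contrapositive_currified; [|now apply ln_neq_0].
  apply Rmult_integral_contrapositive_currified; auto.
  apply Rinv_neq_0_compat; lra.
Qed.

(** * Unit speed curves in de Sitter space and their tilts *)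

Definition unit_de_sitter_curve (a b : Rbar) (f : R -> vec) : Prop :=
  vsmooth_on a b f /\
  forall v, in_itv a b v ->
    lip (f v) (f v) = 1 /\ lip (vderive f v) (vderive f v) = 1.

(** The conormal of [f] in de Sitter space: [f], [f'] and this vector form a
    moving pseudo-orthonormal frame. *)
Definition conormal (f : R -> vec) (v : R) : vec := lcross (f v) (vderive f v).

(** Up to sign, the geodesic curvature of [f] in de Sitter space. *)
Definition geodesic_curvature (f : R -> vec) (v : R) : R :=
  lip (conormal f v) (vderive (vderive f) v).

(** The curve at constant distance from [f] along the geodesics of de Sitter
    space orthogonal to [f]; the [v]-parameter curves of the surface are its
    homothetic images. *)
Definition tilt (eta : R) (f : R -> vec) (v : R) : vec :=
  vadd (vscal (cosh eta) (f v)) (vscal (sinh eta) (conormal f v)).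

Definition tilt_speed (eta : R) (f : R -> vec) (v : R) : R :=
  cosh eta - geodesic_curvature f v * sinh eta.

(** Differentiate [<f, f> = 1], [<f', f'> = 1] and then [<f, f'> = 0]. *)
Lemma de_sitter_frame (a b : Rbar) (f : R -> vec) (v : R) :
  unit_de_sitter_curve a b f -> in_itv a b v ->
  lip (f v) (vderive f v) = 0 /\
  lip (vderive f v) (vderive (vderive f) v) = 0 /\
  lip (f v) (vderive (vderive f) v) = - 1.
Proof.
  intros [Hs Hf] Hv.
  assert (D : forall y, in_itv a b y -> is_vderive f y (vderive f y)).
  { intros y; now apply vsmooth_on_is_vderive. }
  assert (D2 : is_vderive (vderive f) v (vderive (vderive f) v)).
  { apply vsmooth_on_is_vderive with a b; auto; now apply vsmooth_on_vderive. }
  assert (F : forall y, in_itv a b y -> lip (f y) (vderive f y) = 0).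
  { intros y Hy.
    assert (E := is_derive_lip _ _ _ _ _ (D y Hy) (D y Hy)).
    apply (is_derive_constant_on a b _ 1) in E; auto; [|intros; now apply Hf].
    rewrite (lip_sym (vderive f y)) in E; lra. }
  assert (E1 := is_derive_lip _ _ _ _ _ D2 D2).
  apply (is_derive_constant_on a b _ 1) in E1; auto; [|intros; now apply Hf].
  assert (E2 := is_derive_lip _ _ _ _ _ (D v Hv) D2).
  apply (is_derive_constant_on a b _ 0) in E2; auto.
  destruct (Hf v Hv) as [_ Hv1].
  rewrite (lip_sym (vderive (vderive f) v)) in E1.
  repeat split; auto; lra.
Qed.

Lemma is_vderive_conormal (a b : Rbar) (f : R -> vec) (v : R) :
  unit_de_sitter_curve a b f -> in_itv a b v ->
  is_vderive (conormal f) v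
    (vscal (- geodesic_curvature f v) (vderive f v)).
Proof.
  intros Hf Hv.
  destruct (de_sitter_frame a b f v Hf Hv) as (F1 & F2 & F3).
  destruct Hf as [Hs Hf]; destruct (Hf v Hv) as [_ Hu].
  assert (D := is_vderive_lcross _ _ _ _ _
    (vsmooth_on_is_vderive a b f v Hs Hv)
    (vsmooth_on_is_vderive a b _ v (vsmooth_on_vderive a b f Hs) Hv)).
  rewrite lcross_self in D.
  rewrite (lcross_of_orthogonal (vderive f v) (f v)) in D; auto;
    [|now rewrite lip_sym].
  replace (vscal (- geodesic_curvature f v) (vderive f v)) with
    (vadd vzero (vscal (lip (vderive f v)
      (lcross (f v) (vderive (vderive f) v))) (vderive f v))); [exact D|].
  unfold geodesic_curvature, conormal.
  apply vec_ext; coords; ring.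
Qed.

Lemma is_vderive_tilt (a b : Rbar) (eta : R) (f : R -> vec) (v : R) :
  unit_de_sitter_curve a b f -> in_itv a b v ->
  is_vderive (tilt eta f) v (vscal (tilt_speed eta f v) (vderive f v)).
Proof.
  intros Hf Hv.
  assert (D := is_vderive_vadd _ _ _ _ _
    (is_vderive_vscal (cosh eta) _ _ _
      (vsmooth_on_is_vderive a b f v (proj1 Hf) Hv))
    (is_vderive_vscal (sinh eta) _ _ _
      (is_vderive_conormal a b f v Hf Hv))).
  replace (vscal (tilt_speed eta f v) (vderive f v)) with
    (vadd (vscal (cosh eta) (vderive f v))
      (vscal (sinh eta)
        (vscal (- geodesic_curvature f v) (vderive f v)))); [exact D|].
  unfold tilt_speed; apply vec_ext; coords; ring.
Qed.

Lemma lip_tilt (a b : Rbar) (eta : R) (f : R -> vec) (v : R) :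
  unit_de_sitter_curve a b f -> in_itv a b v ->
  lip (tilt eta f v) (tilt eta f v) = 1.
Proof.
  intros Hf Hv.
  destruct (de_sitter_frame a b f v Hf Hv) as (F1 & _ & _).
  destruct (proj2 Hf v Hv) as [E1 E2].
  assert (H := lip_lcross_self (f v) (vderive f v)).
  rewrite E1, E2, F1 in H.
  replace (lip (tilt eta f v) (tilt eta f v)) with
    (cosh eta * cosh eta * lip (f v) (f v)
     + sinh eta * sinh eta * lip (conormal f v) (conormal f v)).
  - unfold conormal; rewrite E1, H.
    assert (C := cosh_sqr_sinh_sqr eta); lra.
  - unfold tilt, conormal; coords; ring.
Qed.

Lemma vsmooth_on_conormal (a b : Rbar) (f : R -> vec) :
  vsmooth_on a b f -> vsmooth_on a b (conormal f).
Proof.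
  intros Hf; apply vsmooth_on_lcross; auto using vsmooth_on_vderive.
Qed.

Lemma vsmooth_on_tilt (a b : Rbar) (eta : R) (f : R -> vec) :
  vsmooth_on a b f -> vsmooth_on a b (tilt eta f).
Proof.
  intros Hf; apply vsmooth_on_vadd; apply vsmooth_on_vscal;
    auto using vsmooth_on_conormal.
Qed.

Lemma tilt_speed_continuous (a b : Rbar) (eta : R) (f : R -> vec) (v : R) :
  vsmooth_on a b f -> in_itv a b v -> continuous (tilt_speed eta f) v.
Proof.
  intros Hf Hv.
  assert (S : smooth_on a b (fun y => sinh eta * geodesic_curvature f y)).
  { apply smooth_on_scal, smooth_on_lip;
      auto using vsmooth_on_conormal, vsmooth_on_vderive. }
  apply (continuous_ext (fun y => minus (cosh eta)
    (sinh eta * geodesic_curvature f y))).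
  - intros y; unfold tilt_speed, minus, plus, opp; simpl; ring.
  - apply (@continuous_minus R_UniformSpace R_AbsRing R_NormedModule).
    + apply continuous_const.
    + now apply smooth_on_continuous with a b.
Qed.

(** * The Frenet apparatus of an integral of a tilt *)

(** The integral of a [v]-parameter curve has velocity [m tilt eta f] in [v],
    hence [tilt eta f] in its arc length [s = m v]. *)
Definition integrates_tilt (a b : Rbar) (m : posreal) (eta : R)
    (f al : R -> vec) : Prop :=
  forall s, in_itv (Rbar_mult_pos a m) (Rbar_mult_pos b m) s ->
    is_vderive al s (tilt eta f (/ m * s)).

Lemma in_itv_unscale (a b : Rbar) (m : posreal) (s : R) :
  in_itv (Rbar_mult_pos a m) (Rbar_mult_pos b m) s -> in_itv a b (/ m * s).
Proof.
  intros Hs; apply in_itv_mult_pos with m.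
  replace (/ m * s * m) with s; auto.
  field; apply Rgt_not_eq, cond_pos.
Qed.

Lemma vderive_frT (a b : Rbar) (m : posreal) (eta : R) (f al : R -> vec)
    (s : R) :
  unit_de_sitter_curve a b f -> integrates_tilt a b m eta f al ->
  in_itv (Rbar_mult_pos a m) (Rbar_mult_pos b m) s ->
  vderive (frT al) s
  = vscal (/ m * tilt_speed eta f (/ m * s)) (vderive f (/ m * s)).
Proof.
  intros Hf Ha Hs; apply is_vderive_unique.
  apply is_vderive_ext_loc with (fun r => tilt eta f (/ m * r)).
  - apply (in_itv_locally _ _ _ _ Hs); intros y Hy.
    symmetry; now apply is_vderive_unique, Ha.
  - rewrite <- vscal_vscal; apply is_vderive_rescale.
    apply is_vderive_tilt with a b; auto using in_itv_unscale.
Qed.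

(** The derivative [w f' / m] of the tangent has norm [|w| / m], where [w] is the
    tilt speed; writing [|w|] as [sg w] with a constant sign [sg] makes the
    curvature affine in the geodesic curvature. *)
Lemma curvature_of_tilt_integral (a b : Rbar) (m : posreal) (eta sg : R)
    (f al : R -> vec) (s : R) :
  unit_de_sitter_curve a b f -> integrates_tilt a b m eta f al ->
  sg * sg = 1 -> 0 < sg * tilt_speed eta f (/ m * s) ->
  in_itv (Rbar_mult_pos a m) (Rbar_mult_pos b m) s ->
  curvature al s = sg * tilt_speed eta f (/ m * s) / m.
Proof.
  intros Hf Ha Hsg Hp Hs; unfold curvature.
  rewrite (vderive_frT a b m eta f); auto.
  rewrite pnorm_vscal_unit by (apply Hf, in_itv_unscale, Hs).
  assert (Hm := Rinv_0_lt_compat _ (cond_pos m)).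
  rewrite Rabs_mult, (Rabs_pos_eq (/ m)) by lra.
  unfold Rdiv; rewrite Rmult_comm; f_equal.
  rewrite <- (Rabs_pos_eq (sg * _)) by lra; rewrite Rabs_mult.
  replace (Rabs sg) with 1; [ring|].
  assert (sg = 1 \/ sg = - 1) as [-> | ->].
  { assert ((sg - 1) * (sg + 1) = 0) as H by lra.
    apply Rmult_integral in H; lra. }
  - now rewrite Rabs_R1.
  - rewrite Rabs_left; lra.
Qed.

Lemma frN_of_tilt_integral (a b : Rbar) (m : posreal) (eta sg : R)
    (f al : R -> vec) (s : R) :
  unit_de_sitter_curve a b f -> integrates_tilt a b m eta f al ->
  sg * sg = 1 -> 0 < sg * tilt_speed eta f (/ m * s) ->
  in_itv (Rbar_mult_pos a m) (Rbar_mult_pos b m) s ->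
  frN al s = vscal sg (vderive f (/ m * s)).
Proof.
  intros Hf Ha Hsg Hp Hs; unfold frN; fold (curvature al s).
  rewrite (curvature_of_tilt_integral a b m eta sg f), (vderive_frT a b m eta f);
    auto.
  assert (Hm := cond_pos m).
  assert (Hw : tilt_speed eta f (/ m * s) <> 0) by (intros E; rewrite E in Hp; lra).
  assert (Hsg0 : sg <> 0) by (intros E; rewrite E in Hp; lra).
  rewrite vscal_vscal; f_equal.
  transitivity (/ sg); [field; repeat split; lra|].
  apply Rmult_eq_reg_l with sg; auto; rewrite Hsg; now apply Rinv_r.
Qed.

(** In [f' x T] the two terms are [f' x f = - h] and [f' x h = - f], whose
    products with [f''] are [- k] and [1]. *)
Lemma lip_binormal (a b : Rbar) (eta : R) (f : R -> vec) (v : R) :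
  unit_de_sitter_curve a b f -> in_itv a b v ->
  lip (vderive (vderive f) v) (lcross (vderive f v) (tilt eta f v))
  = sinh eta - geodesic_curvature f v * cosh eta.
Proof.
  intros Hf Hv.
  destruct (de_sitter_frame a b f v Hf Hv) as (F1 & F2 & F3).
  destruct (proj2 Hf v Hv) as [_ Hu].
  replace (lip _ _) with
    (- cosh eta * geodesic_curvature f v
     + sinh eta * lip (vderive (vderive f) v)
         (lcross (vderive f v) (conormal f v))).
  - unfold conormal at 1; rewrite lcross_lcross, Hu, (lip_sym _ (f v)), F1.
    replace (lip _ _) with (- lip (f v) (vderive (vderive f) v)).
    + rewrite F3; ring.
    + coords; ring.
  - unfold tilt, geodesic_curvature, conormal; coords; ring.
Qed.

Lemma torsion_of_tilt_integral (a b : Rbar) (m : posreal) (eta sg : R)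
    (f al : R -> vec) (s : R) :
  unit_de_sitter_curve a b f -> integrates_tilt a b m eta f al ->
  sg * sg = 1 -> (forall v, in_itv a b v -> 0 < sg * tilt_speed eta f v) ->
  in_itv (Rbar_mult_pos a m) (Rbar_mult_pos b m) s ->
  torsion al s
  = - (sinh eta - geodesic_curvature f (/ m * s) * cosh eta) / m.
Proof.
  intros Hf Ha Hsg Hp Hs.
  assert (Hv := in_itv_unscale a b m s Hs).
  assert (EN : forall r, in_itv (Rbar_mult_pos a m) (Rbar_mult_pos b m) r ->
    frN al r = vscal sg (vderive f (/ m * r))).
  { intros r Hr; apply (frN_of_tilt_integral a b m eta); auto.
    now apply Hp, in_itv_unscale. }
  assert (DN : vderive (frN al) s
    = vscal sg (vscal (/ m) (vderive (vderive f) (/ m * s)))).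
  { apply is_vderive_unique.
    apply is_vderive_ext_loc with (fun r => vscal sg (vderive f (/ m * r))).
    - apply (in_itv_locally _ _ _ _ Hs); intros r Hr; symmetry; auto.
    - apply is_vderive_vscal, is_vderive_rescale, (vsmooth_on_is_vderive a b);
        auto.
      apply vsmooth_on_vderive, Hf. }
  unfold torsion, frB; rewrite DN, EN by auto.
  unfold frT; rewrite (is_vderive_unique _ _ _ (Ha s Hs)).
  rewrite <- (lip_binormal a b) by auto.
  replace (lip _ _) with (sg * sg * / m *
    lip (vderive (vderive f) (/ m * s))
      (lcross (vderive f (/ m * s)) (tilt eta f (/ m * s)))).
  - rewrite Hsg; unfold Rdiv; ring.
  - generalize (tilt eta f (/ m * s)); intros y; coords; ring.
Qed.

(** The reparametrization is [s |-> s / m]; eliminating the geodesic curvature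
    from the formulas for curvature and torsion gives the linear relation. *)
Lemma integral_of_tilt_Bertrand (a b : Rbar) (m : posreal) (eta : R)
    (f ga : R -> vec) (v0 : R) :
  unit_de_sitter_curve a b f -> in_itv a b v0 ->
  (forall v, in_itv a b v -> tilt_speed eta f v <> 0) ->
  eta <> 0 ->
  (forall v, in_itv a b v -> is_vderive ga v (vscal m (tilt eta f v))) ->
  spacelike_Bertrand_curve a b ga.
Proof.
  intros Hf H0 Hw Heta Hga.
  assert (Hm := cond_pos m).
  assert (Sga : vsmooth_on a b ga).
  { apply vsmooth_on_primitive with (1 := Hga).
    apply vsmooth_on_vscal, vsmooth_on_tilt, Hf. }
  assert (Lga : forall v, in_itv a b v ->
    lip (vderive ga v) (vderive ga v) = m * m).
  { intros v Hv; rewrite (is_vderive_unique _ _ _ (Hga v Hv)).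
    rewrite lip_vscal, (lip_tilt a b) by auto; ring. }
  split.
  { split; [split|]; auto; intros v Hv.
    - apply nonnull_nonzero; rewrite Lga by auto; nra.
    - left; rewrite Lga by auto; nra. }
  set (al := fun s => ga (/ m * s)).
  exists (Rbar_mult_pos a m), (Rbar_mult_pos b m), al.
  assert (Hal : integrates_tilt a b m eta f al).
  { intros s Hs; apply in_itv_unscale in Hs.
    replace (tilt eta f (/ m * s))
      with (vscal (/ m) (vscal m (tilt eta f (/ m * s)))).
    - now apply is_vderive_rescale, Hga.
    - rewrite vscal_vscal, Rinv_l by lra; apply vscal_1. }
  assert (Val : forall s, in_itv (Rbar_mult_pos a m) (Rbar_mult_pos b m) s ->
    lip (vderive al s) (vderive al s) = 1).
  { intros s Hs; rewrite (is_vderive_unique _ _ _ (Hal s Hs)).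
    now apply (lip_tilt a b), in_itv_unscale. }
  split; [|split].
  - exists (fun s => / m * s); split; [|split].
    + apply (smooth_on_rescale a b m (fun v => v)).
      apply smooth_on_primitive with (fun _ => 1).
      * intros t _; auto_derive; auto.
      * intros n t _; apply ex_derive_n_const.
    + intros s Hs; split; [|split; auto].
      * now apply in_itv_unscale.
      * rewrite (is_derive_unique _ _ (/ m)).
        -- now apply Rinv_0_lt_compat.
        -- auto_derive; auto; ring.
    + intros t Ht; exists (t * m); split; [now apply in_itv_mult_pos|].
      field; lra.
  - split; [split; [split|]|split].
    + now apply vsmooth_on_rescale.
    + intros s Hs; apply nonnull_nonzero; rewrite Val by auto; lra.
    + intros s Hs; left; rewrite Val by auto; lra.
    + intros s Hs; unfold pnorm; rewrite Val, Rabs_R1 by auto; apply sqrt_1.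
    + intros s Hs.
      assert (Hv := in_itv_unscale a b m s Hs).
      assert (L : 0 < lip (vderive (frT al) s) (vderive (frT al) s)).
      { rewrite (vderive_frT a b m eta f) by auto.
        rewrite lip_vscal, (proj2 (proj2 Hf _ Hv)), Rmult_1_r.
        apply (Rsqr_pos_lt (/ m * tilt_speed eta f (/ m * s))).
        apply Rmult_integral_contrapositive_currified; auto.
        apply Rinv_neq_0_compat; lra. }
      split; [now left | apply nonnull_nonzero; lra].
  - assert (exists sg, sg * sg = 1 /\
      forall v, in_itv a b v -> 0 < sg * tilt_speed eta f v) as (sg & Hsg & Hp).
    { assert (P := nonvanishing_constant_sign a b (tilt_speed eta f)
        (fun v Hv => tilt_speed_continuous a b eta f v (proj1 Hf) Hv) Hw v0).
      destruct (Rlt_or_le 0 (tilt_speed eta f v0)) as [Hpos|Hneg].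
      - exists 1; split; [ring|]; intros v Hv; specialize (P v H0 Hv); nra.
      - exists (- 1); split; [ring|]; intros v Hv; specialize (P v H0 Hv); nra. }
    assert (Hc := cosh_pos eta); assert (Hsh := sinh_neq_0 eta Heta).
    exists (sg * m * cosh eta), (m * sinh eta); split; [|split].
    + assert (Hsg0 : sg <> 0) by (intros E; rewrite E in Hsg; lra).
      apply Rmult_integral_contrapositive_currified; [|lra].
      apply Rmult_integral_contrapositive_currified; lra.
    + apply Rmult_integral_contrapositive_currified; lra.
    + intros s Hs.
      rewrite (curvature_of_tilt_integral a b m eta sg f) by
        (auto using in_itv_unscale).
      rewrite (torsion_of_tilt_integral a b m eta sg f) by auto.
      unfold tilt_speed.
      generalize (geodesic_curvature f (/ m * s)); intros k.
      transitivity (sg * sg * cosh eta * (cosh eta - k * sinh eta)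
        - sinh eta * (sinh eta - k * cosh eta)); [field; lra|].
      rewrite Hsg; assert (C := cosh_sqr_sinh_sqr eta); lra.
Qed.

(** * The parameter curves of the surface *)

Theorem theorem2 :
  forall (u1 u2 a b : Rbar) (x : R -> R -> vec) (theta : R) (f : R -> vec),
    Rbar_le 0 u1 ->
    in_itv a b 0 ->
    spacelike_constant_slope_surface u1 u2 a b x ->
    theta <> 0 ->
    spacelike_curve a b f ->
    unit_speed a b f ->
    (forall v, in_itv a b v -> de_sitter (f v)) ->
    (forall u v, in_itv u1 u2 u -> in_itv a b v -> x u v = slope_param theta f u v) ->
    forall u0 : R,
      in_itv u1 u2 u0 ->
      u0 <> 1 ->
      spacelike_Bertrand_curve a b (fun v => vint (x u0) 0 v).
Proof.
  intros u1 u2 a b x theta f Hu1 H0 Hx Htheta Hf Hunit HdS Hparam u0 Hu0 Hu01.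
  assert (Pu0 : 0 < u0) by exact (Rbar_le_lt_trans 0 u1 u0 Hu1 (proj1 Hu0)).
  assert (Pm : 0 < u0 * cosh theta) by
    (apply Rmult_lt_0_compat; auto using cosh_pos).
  set (m := mkposreal _ Pm); set (eta := xi1 theta u0).
  assert (Hdf : unit_de_sitter_curve a b f).
  { split; [apply Hf|]; intros v Hv; split; [now apply HdS|].
    apply spacelike_pnorm_unit; [now apply (proj2 Hf) | now apply Hunit]. }
  assert (Ex : forall v, in_itv a b v -> vscal m (tilt eta f v) = x u0 v).
  { intros v Hv; symmetry; exact (Hparam u0 v Hu0 Hv). }
  assert (Sx : vsmooth_on a b (x u0)).
  { apply vsmooth_on_ext with (1 := Ex).
    apply vsmooth_on_vscal, vsmooth_on_tilt, Hdf. }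
  apply (integral_of_tilt_Bertrand a b m eta f _ 0); auto.
  (* the immersion forbids [x_v = m w f'] to vanish *)
  - intros v Hv Hw.
    assert (D : pder_v x u0 v = vzero).
    { apply is_vderive_unique.
      apply is_vderive_ext_loc with (fun y => vscal m (tilt eta f y)).
      - now apply (in_itv_locally a b).
      - rewrite <- (vscal_0 (vscal m (vderive f v))), vscal_vscal, Rmult_comm.
        rewrite <- vscal_vscal, <- Hw.
        now apply is_vderive_vscal, is_vderive_tilt with a b. }
    destruct Hx as [[[_ Himm] _] _].
    destruct (Himm u0 v Hu0 Hv 0 1) as [_ E]; [|lra].
    unfold tangent; rewrite D, vscal_0, vscal_1.
    apply vec_ext; coords; ring.
  - now apply xi1_neq_0.
  - intros v Hv; rewrite Ex by auto; now apply is_vderive_vint with a b.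
Qed.
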